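(* Let $\lambda>0$, let $\alpha\in\mathbb{R}$, and let $\eta$ be a sub-Gaussian real random variable with $\mathbb{E}[\eta]=0$ and $\|\eta\|_{\psi_2}<\infty$. Define $\tilde\alpha=\alpha+\eta$. Let $\delta\in(0,1)$ and $c>0$. If \[ \bigl||\alpha|-\lambda\bigr|>c\lambda\quad\text{and}\quad \lambda\ge\frac{\|\eta\|_{\psi_2}}{c}\sqrt{2\ln\frac{2}{\delta}}, \] then \[ \mathbb{P}\left[(|\alpha|-\lambda)(|\tilde\alpha|-\lambda)<0\right]\le\delta . \]
   Context: The sub-Gaussian norm of a real random variable $\eta$ is $\|\eta\|_{\psi_2}:=\inf\{t>0:\ \mathbb{E}\exp(\eta^2/t^2)\le 2\}$. *)

(* Defs.v *)
From HB Require Import structures.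
From mathcomp Require Import all_boot all_order all_algebra.
From mathcomp Require Import all_classical all_reals all_analysis.

Set Implicit Arguments.
Unset Strict Implicit.
Unset Printing Implicit Defensive.

Import Order.TTheory GRing.Theory Num.Theory.
Import numFieldNormedType.Exports.

Local Open Scope classical_set_scope.
Local Open Scope ring_scope.
Local Open Scope ereal_scope.

(* The infimum is taken in the extended reals, so that it is [+oo] when no [t]
   is admissible; [eta] is sub-Gaussian iff [psi2_norm P eta < +oo]. *)
Definition psi2_norm (d : measure_display) (T : measurableType d)
    (R : realType) (P : probability T R) (eta : T -> R) : \bar R :=
  ereal_inf [set t%:E | t in
    [set t : R | (0 < t)%R /\
      'E_P[fun w => expR (eta w ^+ 2 / t ^+ 2)] <= 2%:E]].

(* Main.v *)
Require Import Defs.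
From HB Require Import structures.
From mathcomp Require Import all_boot all_order all_algebra.
From mathcomp Require Import all_classical all_reals all_analysis.
From mathcomp Require Import measurable_realfun ring lra.

Set Implicit Arguments.
Unset Strict Implicit.
Unset Printing Implicit Defensive.

Import Order.TTheory GRing.Theory Num.Theory.
Import numFieldNormedType.Exports.

Local Open Scope classical_set_scope.
Local Open Scope ring_scope.
Local Open Scope ereal_scope.

(* A sign change of [|x| - lambda] between [x = alpha] and [x = alpha + eta]
   forces [|eta| >= ||alpha| - lambda|], so the claim is a tail bound.  The
   strict hypothesis [| |alpha| - lambda | > c lambda] leaves room for an
   admissible [t] with [t sqrt(2 ln(2/delta)) < ||alpha| - lambda|]; Markov's
   inequality for [x |-> exp(x^2/t^2)] then bounds the probability by
   [2 exp(-2 ln(2/delta)) = delta^2/2]. *)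

Lemma sub_gaussian_tail (d : measure_display) (T : measurableType d)
    (R : realType) (P : probability T R) (X : {RV P >-> R}) (t s : R) :
  'E_P[fun w => expR (X w ^+ 2 / t ^+ 2)] <= 2%:E -> (0 < s)%R ->
  P [set w | (s <= `|X w|)%R] <= (2 * expR (- (s ^+ 2 / t ^+ 2)))%:E.
Proof.
move=> EX s0.
pose f (x : R) := expR (x ^+ 2 / t ^+ 2).
have mf : measurable_fun [set: R] f.
  apply: measurableT_comp => //.
  by apply: measurable_funM => //; exact: measurable_funX.
have f0 (x : R) : (0 <= x -> 0 <= f x)%R by move=> _; exact: expR_ge0.
have f_nd : {in Num.nneg &, {homo f : x y / (x <= y)%R}}.
  move=> x y; rewrite !nnegrE => x0 y0 xy.
  by rewrite ler_expR ler_wpM2r ?invr_ge0 ?sqr_ge0// lerXn2r.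
have := markov X s0 mf f0 f_nd.
(* [f] is monotone only on nonnegative reals, so Markov is applied to [|X|]; the square absorbs the
   absolute value. *)
have -> : f \o (fun x => `|x|)%R \o X = fun w => expR (X w ^+ 2 / t ^+ 2).
  by apply/funext => w; rewrite /f /= real_normK ?num_real.
move=> /le_trans /(_ EX).
rewrite muleC -lee_pdivlMr ?expR_gt0// => h.
by rewrite expRN.
Qed.

(** The infimum need not be attained: strictness supplies an admissible [t < s / sqrt L], and then
    [L <= s ^+ 2 / t ^+ 2]. *)
Lemma psi2_norm_tail (d : measure_display) (T : measurableType d)
    (R : realType) (P : probability T R) (X : {RV P >-> R}) (L s : R) :
  (0 < L)%R -> (0 < s)%R ->
  psi2_norm P X < (s / Num.sqrt L)%:E ->
  P [set w | (s <= `|X w|)%R] <= (2 * expR (- L))%:E.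
Proof.
move=> L0 s0 /ereal_inf_lt[_ [t [t0 EX] <-]].
rewrite lte_fin ltr_pdivlMr ?sqrtr_gt0// => ts.
apply: (le_trans (sub_gaussian_tail EX s0)).
rewrite lee_fin ler_pM2l// ler_expR lerN2 ler_pdivlMr ?exprn_gt0//.
rewrite -[X in (X * _)%R](sqr_sqrtr (ltW L0)) -exprMn mulrC.
by rewrite lerXn2r ?nnegrE ?mulr_ge0 ?ltW ?sqrtr_gt0.
Qed.

(** [l] lies strictly between [|a|] and [|a + b|], which are at most [|b|] apart. *)
Lemma sign_change_ge_dist (R : realDomainType) (a b l : R) :
  ((`|a| - l) * (`|a + b| - l) < 0 -> `| `|a| - l | <= `|b|)%R.
Proof.
move=> ab.
have h1 : (`|a + b| <= `|a| + `|b|)%R by exact: ler_normD.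
have h2 : (`|a| <= `|a + b| + `|b|)%R.
  by rewrite -{1}(addrK b a) -(normrN b); exact: ler_normD.
(* If either bound failed, [h1] or [h2] would give both factors of [ab] the same sign. *)
rewrite ler_norml; apply/andP; split; nra.
Qed.

Theorem corollary5p1 (d : measure_display) (T : measurableType d)
    (R : realType) (P : probability T R) (lambda alpha : R)
    (eta : {RV P >-> R}) (delta c : R) :
  (0 < lambda)%R ->
  'E_P[eta] = 0 ->
  psi2_norm P eta < +oo ->
  (0 < delta < 1)%R ->
  (0 < c)%R ->
  (`| `|alpha| - lambda | > c * lambda)%R ->
  lambda%:E >= psi2_norm P eta * (c^-1)%:E * (Num.sqrt (2 * ln (2 / delta)))%:E ->
  P [set w | ((`|alpha| - lambda) * (`|alpha + eta w| - lambda) < 0)%R] <= delta%:E.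
Proof.
move=> lambda0 _ _ /andP[delta0 delta1] c0.
set s := `| _ - _ |%R; set L := (2 * _)%R => cs hK.
have s0 : (0 < s)%R by rewrite (lt_trans _ cs)// mulr_gt0.
have L0 : (0 < L)%R.
  by rewrite mulr_gt0// ln_gt0// ltr_pdivlMr// mul1r (lt_trans delta1)// ltr1n.
(* [hK] bounds the norm by [c * lambda / sqrt L]; strictness comes from [c * lambda < s]. *)
have norm_lt : psi2_norm P eta < (s / Num.sqrt L)%:E.
  move: hK; rewrite -muleA -EFinM -lee_pdivlMr; last first.
    by rewrite mulr_gt0 ?invr_gt0 ?sqrtr_gt0.
  move=> /le_lt_trans; apply.
  by rewrite -EFinM lte_fin invfM invrK mulrA [(lambda * c)%R]mulrC ltr_pM2r
    ?invr_gt0 ?sqrtr_gt0.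
(* Monotonicity of [P] needs both events measurable; each is the preimage of [true] under a
   measurable boolean map. *)
have m_tail : measurable [set w | (s <= `|eta w|)%R].
  rewrite -[X in measurable X]setTI.
  have mf : measurable_fun setT (fun w => (s <= `|eta w|)%R).
    by apply: measurable_fun_ler => //; exact: measurableT_comp.
  exact: (mf measurableT [set true]).
have m_event :
    measurable [set w | ((`|alpha| - lambda) * (`|alpha + eta w| - lambda) < 0)%R].
  rewrite -[X in measurable X]setTI.
  have mf : measurable_fun setT
      (fun w => ((`|alpha| - lambda) * (`|alpha + eta w| - lambda) < 0)%R).
    apply: measurable_fun_ltr => //; apply: measurable_funM => //.
    apply: measurable_funB => //; apply: measurableT_comp => //.
    exact: measurable_funD.
  exact: (mf measurableT [set true]).
apply: (@le_trans _ _ (P [set w | (s <= `|eta w|)%R])).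
  by apply: le_measure; rewrite ?inE// => w; exact: sign_change_ge_dist.
apply: (le_trans (psi2_norm_tail L0 s0 norm_lt)).
(* The factor 2 in [L] becomes a square: [expR L] is [(2 / delta) ^+ 2]. *)
rewrite lee_fin expRN expRM_natl lnK ?posrE ?divr_gt0//.
have -> : (2 * ((2 / delta) ^+ 2)^-1 = delta * (delta / 2))%R by field; lra.
nra.
Qed.
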